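(* Let $S$ be a semigroup. If $S$ is finitely generated, then $S$ is f-noetherian.
   Context: A right congruence on a semigroup $S$ is an equivalence relation $\rho$ on $S$ such that $(a,b)\in\rho$ implies $(as,bs)\in\rho$ for all $s\in S$. The right congruence generated by a set $X\subseteq S\times S$ is the smallest right congruence on $S$ containing $X$; a right congruence is finitely generated if it is generated by some finite set $X$. The index of an equivalence relation is the cardinality of its set of equivalence classes. A semigroup $S$ is f-noetherian if every right congruence of finite index on $S$ is finitely generated (as a right congruence). *)

(* Defs.v *)
From Stdlib Require Import RelationClasses.
From mathcomp Require Import all_boot.
From mathcomp Require Import boolp classical_sets functions cardinality.

Set Implicit Arguments.
Unset Strict Implicit.
Unset Printing Implicit Defensive.

Local Open Scope group_scope.
Local Open Scope classical_set_scope.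

(* Relations on S are sets of pairs. A [semigroupType] may be empty and carries
   a choice structure; classically every type has one ([{classic T}]). *)

Definition subsemigroup (S : semigroupType) (A : set S) : Prop :=
  forall a b : S, A a -> A b -> A (a * b).

Definition finitely_generated (S : semigroupType) : Prop :=
  exists2 A : set S, finite_set A & smallest (@subsemigroup S) A = [set: S].

Definition equivalence_relation (T : Type) (rho : set (T * T)) : Prop :=
  Equivalence (fun a b => rho (a, b)).

Definition right_congruence (S : semigroupType) (rho : set (S * S)) : Prop :=
  equivalence_relation rho /\
  forall a b s : S, rho (a, b) -> rho (a * s, b * s).

Definition right_congruence_generated_by (S : semigroupType)
    (X : set (S * S)) : set (S * S) :=
  smallest (@right_congruence S) X.

Definition finitely_generated_right_congruence (S : semigroupType)
    (rho : set (S * S)) : Prop :=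
  exists2 X : set (S * S), finite_set X & right_congruence_generated_by X = rho.

Definition equivalence_classes (T : Type) (rho : set (T * T)) : set (set T) :=
  range (fun a => [set b | rho (a, b)]).

Definition finite_index (T : Type) (rho : set (T * T)) : Prop :=
  finite_set (equivalence_classes rho).

Definition f_noetherian (S : semigroupType) : Prop :=
  forall rho : set (S * S), right_congruence rho -> finite_index rho ->
    finitely_generated_right_congruence rho.

(* Main.v *)
Require Import Defs.
From mathcomp Require Import all_boot.
From mathcomp Require Import boolp classical_sets functions cardinality.

(** Let [A] be a finite generating set of [S] and let [R] be a finite set that
    meets every class of [rho]. The finitely many pairs of [rho] whose
    components lie in [F = A `|` R `|` R * A] already generate [rho]: modulo the
    right congruence [sigma] that they generate, every generator and every
    product [t * a] of a representative by a generator equals a representative,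
    so a word in the generators can be rewritten from left to right, each prefix
    being replaced by a representative. Hence [R] meets every class of [sigma]
    ([transversal_of_generators]). If then [rho] relates [x] and [y], they are
    [sigma]-related to representatives [t] and [u], which are [rho]-related since
    [sigma `<=` rho]; the pair [(t, u)] is one of the generating pairs, so [sigma]
    relates [x] and [y]. *)

Set Implicit Arguments.
Unset Strict Implicit.
Unset Printing Implicit Defensive.

Local Open Scope group_scope.
Local Open Scope classical_set_scope.

Section Equivalences.
Variables (T : Type) (rho : set (T * T)).
Hypothesis eq_rho : equivalence_relation rho.

Lemma equivalence_refl x : rho (x, x).
Proof. by case: eq_rho. Qed.

Lemma equivalence_sym x y : rho (x, y) -> rho (y, x).
Proof. by case: eq_rho => _ + _; apply. Qed.

Lemma equivalence_trans y x z : rho (x, y) -> rho (y, z) -> rho (x, z).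
Proof. by case: eq_rho => _ _; apply. Qed.

End Equivalences.

(** Classical choice picks one preimage of each value. Choosing in [option T]
    keeps the argument uniform when [T] is empty. *)
Lemma finite_range_section (T U : Type) (f : T -> U) :
  finite_set (range f) ->
  exists2 R : set T, finite_set R & forall x, exists2 t, R t & f x = f t.
Proof.
move=> fin_f.
have /choice[g gP] (y : U) :
    exists o : option T, range f y -> exists2 t, o = Some t & f t = y.
  have [[t _ <-]|noy] := pselect (range f y); last by exists None.
  by exists (Some t) => _; exists t.
exists (Some @^-1` (g @` range f)).
  apply: finite_preimage; last exact: finite_image.
  by move=> x y _ _ [].
move=> x; have [t gt ft] := gP (f x) (imageT f x).
by exists t => //; exists (f x) => //; exact: imageT.
Qed.

Lemma finite_index_transversal (T : Type) (rho : set (T * T)) :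
  equivalence_relation rho -> finite_index rho ->
  exists2 R : set T, finite_set R & forall x, exists2 t, R t & rho (x, t).
Proof.
move=> eq_rho /finite_range_section[R finR Rrho]; exists R => // x.
have [t Rt class_xt] := Rrho x; exists t => //.
have : [set b | rho (t, b)] t by exact: equivalence_refl.
by rewrite -class_xt.
Qed.

Section RightCongruences.
Variable S : semigroupType.

Lemma right_congruence_generatedP (X : set (S * S)) :
  right_congruence (right_congruence_generated_by X).
Proof.
split; first split.
- by move=> x rho [[eq_rho _] _]; exact: equivalence_refl.
- move=> x y sxy rho rhoX; have [[eq_rho _] _] := rhoX.
  exact: equivalence_sym (sxy _ rhoX).
- move=> x y z sxy syz rho rhoX; have [[eq_rho _] _] := rhoX.
  exact: equivalence_trans (sxy _ rhoX) (syz _ rhoX).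
- by move=> x y s sxy rho rhoX; have [[_ cong] _] := rhoX; exact: cong (sxy _ rhoX).
Qed.

(** The elements that right multiplication sends from [R] into the
    [sigma]-saturation of [R], and that lie in this saturation themselves, form
    a subsemigroup: in [u * (a * b)], the factor [u * a] may be replaced by a
    representative before multiplying by [b], since [sigma] is compatible with
    right multiplication. *)
Lemma transversal_of_generators (sigma : set (S * S)) (A R : set S) :
  right_congruence sigma -> smallest (@subsemigroup S) A = [set: S] ->
  (forall a, A a -> exists2 t, R t & sigma (a, t)) ->
  (forall u a, R u -> A a -> exists2 t, R t & sigma (u * a, t)) ->
  forall x, exists2 t, R t & sigma (x, t).
Proof.
move=> [eq_sigma cong] genA AR RAR x.
pose B := [set s | (exists2 t, R t & sigma (s, t)) /\
                   forall u, R u -> exists2 t, R t & sigma (u * s, t)].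
suff [] : B x by [].
have : smallest (@subsemigroup S) A x by rewrite genA.
apply; split => [a b [[t Rt at_] Ra] [_ Rb]|a Aa]; last first.
  by split=> [|u Ru]; [exact: AR|exact: RAR].
split=> [|u Ru].
  have [v Rv tbv] := Rb t Rt.
  by exists v => //; apply: (equivalence_trans eq_sigma) tbv; exact: cong.
have [w Rw uaw] := Ra u Ru; have [v Rv wbv] := Rb w Rw.
exists v => //; rewrite mulgA.
by apply: (equivalence_trans eq_sigma) wbv; exact: cong.
Qed.

End RightCongruences.

Theorem proposition4p1 (S : semigroupType) :
  finitely_generated S -> f_noetherian S.
Proof.
move=> [A finA genA] rho cong_rho fin_rho.
have [eq_rho _] := cong_rho.
have [R finR Rrho] := finite_index_transversal eq_rho fin_rho.
pose F := A `|` R `|` [set u * a | u in R & a in A].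
have finF : finite_set F.
  rewrite !finite_setU; split; first by split.
  exact: finite_image2.
pose X := rho `&` (F `*` F).
have finX : finite_set X.
  by apply: (sub_finite_set (@subIsetr _ _ _)); exact: finite_setX.
exists X => //.
set sigma := right_congruence_generated_by X.
have cong_sigma : right_congruence sigma by exact: right_congruence_generatedP.
have [eq_sigma _] := cong_sigma.
have sub_sigma : X `<=` sigma by exact: sub_gen_smallest.
have sigma_rho : sigma `<=` rho by apply: smallest_sub => // p [].
have FR x : F x -> exists2 t, R t & sigma (x, t).
  move=> Fx; have [t Rt xt] := Rrho x; exists t => //.
  by apply: sub_sigma; split=> //; split=> //; left; right.
have Rsigma : forall x, exists2 t, R t & sigma (x, t).
  apply: (transversal_of_generators cong_sigma genA) => [a Aa|u a Ru Aa].
    by apply: FR; left; left.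
  by apply: FR; right; exists u => //; exists a.
apply/seteqP; split=> // -[x y] xy.
have [[t Rt xt] [u Ru yu]] := (Rsigma x, Rsigma y).
have tu : sigma (t, u).
  apply: sub_sigma; split; last by split; left; right.
  apply: (equivalence_trans eq_rho) (sigma_rho _ yu).
  by apply: (equivalence_trans eq_rho) xy; exact/(equivalence_sym eq_rho)/sigma_rho.
apply: (equivalence_trans eq_sigma xt).
exact: (equivalence_trans eq_sigma tu) (equivalence_sym eq_sigma yu).
Qed.
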